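(* Let $\psi:\mathbb{N}\to[0,\infty)$ be an arbitrary nonnegative, decreasing function. Then there exists a Rajchman measure $\mu$ supported on a compact subset of the set $E(\psi)$ of $\psi$-well-approximable numbers.
   Context: $\mathbb{N}=\{1,2,\dots\}$. $E(\psi)=\{x\in\mathbb{R}: |x-\frac pq|\le\psi(q)\text{ for infinitely many pairs of integers }(p,q),\ q\ge1\}$. A Rajchman measure is a (nonzero, finite, positive) Borel measure $\mu$ on $\mathbb{R}$ with $|\hat\mu(\xi)|\to0$ as $|\xi|\to\infty$, where $\hat\mu(\xi)=\int e^{-2\pi i x\xi}\,d\mu(x)$.
   Formalization: The function ψ is assumed strictly positive (and non-increasing) instead of merely nonnegative: if ψ vanishes somewhere it vanishes from there on, E(ψ) is then the countable set of rationals, and no nonzero Rajchman measure, being atomless, can be supported there. *)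

(* Defs.v *)
From HB Require Import structures.
From mathcomp Require Import all_boot all_order all_algebra.
From mathcomp Require Import all_classical all_reals all_analysis.
From mathcomp Require Import complex.

Set Implicit Arguments.
Unset Strict Implicit.
Unset Printing Implicit Defensive.

Import Order.TTheory GRing.Theory Num.Theory.
Import numFieldNormedType.Exports.

Local Open Scope classical_set_scope.
Local Open Scope ring_scope.
Local Open Scope complex_scope.

(* The pairs (p, q) are not required to be coprime.  The functions psi of
   interest live on {1, 2, ...}; the value psi 0 is never used. *)
Definition well_approximable (R : realType) (psi : nat -> R) : set R :=
  [set x | infinite_set
    [set pq : int * nat |
      (1 <= pq.2)%N /\ `|x - pq.1%:~R / pq.2%:R| <= psi pq.2]].

(* The complex number e^{i t}. *)
Definition expi (R : realType) (t : R) : R[i] := cos t +i* sin t.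

(* Componentwise Lebesgue integral of a complex-valued function; the
   components are only meaningful when they are mu-integrable, which is the
   case for bounded measurable functions and finite mu. *)
Definition cintegral (d : measure_display) (T : measurableType d)
    (R : realType) (mu : {measure set T -> \bar R}) (f : T -> R[i]) : R[i] :=
  Rintegral mu setT (fun x => complex.Re (f x)) +i*
  Rintegral mu setT (fun x => complex.Im (f x)).

Definition fourier (R : realType)
    (mu : {finite_measure set (measurableTypeR R) -> \bar R}) (xi : R) : R[i] :=
  cintegral mu (fun x : R => expi (- (2 * pi * x * xi))).

(* The second conjunct says that |fourier mu xi| tends to 0 as |xi| tends to
   infinity; normc is the R-valued modulus of a complex number. *)
Definition Rajchman (R : realType)
    (mu : {finite_measure set (measurableTypeR R) -> \bar R}) : Prop :=
  mu setT <> 0%E /\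
  forall e : R, 0 < e -> exists M : R, forall xi : R,
    M <= `|xi| -> Normc.normc (fourier mu xi) < e.

Definition supported_on (R : realType)
    (mu : {finite_measure set (measurableTypeR R) -> \bar R}) (K : set R) :
  Prop := mu (~` K) = 0%E.

(* Main.v *)
(** Let q_0 = 1 and let q_(l+1) be a multiple of q_l that is huge compared with
    1 / psi(q_l).  Take X = sum_l d_l / q_(l+1) with d_l uniform on [0, L_l),
    L_l = 16 (l+1) q_(l+1) / q_l.  If |xi| lies in [q_l / 16, q_(l+1) / 16], a
    geometric sum bounds the characteristic function of the single term
    d_l / q_(l+1) by 1 / (l+1).  If d_l = 0, the terms before l add up to a
    multiple of 1 / q_l and those after l to at most psi(q_l), so X is within
    psi(q_l) of a fraction p / q_l.  Both effects are reconciled by cutting the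
    indices into blocks, the k-th one of length k+1, and replacing one digit of
    each block, chosen uniformly at random, by 0: every realization of X then
    has infinitely many good approximations, while a given frequency loses its
    digit with probability only 1 / (k+1).  The law of X is the measure. *)
Require Import Defs.
From mathcomp Require Import all_boot all_order all_algebra.
From mathcomp Require Import all_classical all_reals all_analysis.
From mathcomp Require Import measurable_realfun complex ring lra zify.

Set Implicit Arguments.
Unset Strict Implicit.
Unset Printing Implicit Defensive.

Import Order.TTheory GRing.Theory Num.Theory.
Import numFieldNormedType.Exports.

Local Open Scope classical_set_scope.
Local Open Scope ring_scope.
Local Open Scope complex_scope.

(** * The exponential [expi] and moduli of exponential sums *)

Lemma normc_expi {R : realType} (t : R) : Normc.normc (expi t) = 1.
Proof. by rewrite /Normc.normc /expi cos2Dsin2 sqrtr1. Qed.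

Lemma expiD {R : realType} (s t : R) : expi (s + t) = expi s * expi t.
Proof.
rewrite /expi cosD sinD; apply/eqP; rewrite eq_complex /= eqxx /=.
by rewrite addrC [cos s * sin t]mulrC.
Qed.

Lemma expi0 {R : realType} : expi (0 : R) = 1.
Proof. by rewrite /expi cos0 sin0. Qed.

Lemma expi_sum {R : realType} (n : nat) (F : nat -> R) :
  expi (\sum_(i < n) F i) = \prod_(i < n) expi (F i).
Proof.
elim: n => [|n IHn]; first by rewrite !big_ord0 expi0.
by rewrite !big_ord_recr /= expiD IHn.
Qed.

Lemma expiMn {R : realType} (t : R) (n : nat) : expi (t *+ n) = expi t ^+ n.
Proof.
elim: n => [|n IHn]; first by rewrite expr0 expi0.
by rewrite mulrS expiD IHn exprS.
Qed.

Lemma normc_sum_le {R : realType} (I : finType) (F : I -> R[i]) :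
  Normc.normc (\sum_i F i) <= \sum_i Normc.normc (F i).
Proof.
elim/big_ind2: _ => [|x1 x2 y1 y2 h1 h2|//]; first by rewrite Normc.normc0.
exact: le_trans (le_normcD _ _) (lerD h1 h2).
Qed.

Lemma normc_prod {R : realType} (I : finType) (F : I -> R[i]) :
  Normc.normc (\prod_i F i) = \prod_i Normc.normc (F i).
Proof. by apply: (big_morph _ (@Normc.normcM R)); exact: Normc.normc1. Qed.

Lemma normc_ge0 {R : realType} (z : R[i]) : 0 <= Normc.normc z.
Proof. by case: z => a b; exact: sqrtr_ge0. Qed.

Lemma Im_le_normc {R : realType} (z : R[i]) : `|complex.Im z| <= Normc.normc z.
Proof.
case: z => a b /=; rewrite -sqrtr_sqr; apply: ler_wsqrtr.
by rewrite lerDr sqr_ge0.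
Qed.

(** By the mean value theorem [sin x = x * cos c] with [c <= 1/2]. Then [2c] is below [pi/2], so
    [2 (cos c)^2 - 1 >= 0], which forces [cos c >= 1/2]. *)
Lemma sin_ge_half {R : realType} (x : R) : 0 <= x -> x <= 1 / 2 -> x / 2 <= sin x.
Proof.
move=> x0 x1.
have [|c] := @MVT_segment R sin cos 0 x x0 (fun y _ => is_derive_sin y).
  by apply: continuous_subspaceT => y; exact: continuous_sin.
rewrite in_itv /= => /andP[c0 cx]; rewrite sin0 !subr0 => ->.
rewrite mulrC ler_wpM2r //.
have c1 : c <= 1 / 2 by exact: le_trans cx x1.
have cp : 0 <= cos c.
  apply: cos_ge0_pihalf; apply/andP; have := @pi_ge2 R; split; lra.
have cp2 : 0 <= cos (c *+ 2).
  apply: cos_ge0_pihalf; apply/andP; rewrite (mulr2n c); have := @pi_ge2 R; split; lra.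
by move: cp2; rewrite cos_mulr2n (mulr2n (_ ^+ 2)); nra.
Qed.

Lemma normc_expi_sub1 {R : realType} (t : R) :
  `|t| <= 1 / 2 -> `|t| / 2 <= Normc.normc (expi t - 1).
Proof.
move=> t1; apply: le_trans (Im_le_normc _).
have -> : complex.Im (expi t - 1) = sin t by rewrite /expi /= subr0.
have [t0|t0] := leP 0 t.
  move: t1; rewrite ger0_norm // => t1.
  by rewrite (le_trans (sin_ge_half t0 t1)) // ler_norm.
move: t1; rewrite ltr0_norm // => t1.
have nt0 : 0 <= - t by lra.
by rewrite -normrN -sinN (le_trans (sin_ge_half nt0 t1)) // ler_norm.
Qed.

(** The sum times [expi t - 1] telescopes to a number of modulus at most 2, while [expi t - 1] has
    modulus at least [|t| / 2]. *)
Lemma normc_geometric_le {R : realType} (L : nat) (t : R) :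
  0 < `|t| -> `|t| <= 1 / 2 ->
  Normc.normc (\sum_(d < L) expi (t *+ d)) <= 4 / `|t|.
Proof.
move=> t0 t1.
under eq_bigr do rewrite expiMn.
have E : Normc.normc (expi t ^+ L - 1) <= 2.
  apply: le_trans (le_normcD _ _) _; rewrite normcN Normc.normc1 -expiMn.
  by rewrite normc_expi.
move: E; rewrite subrX1 Normc.normcM.
set S := Normc.normc (\sum_(_ < _) _) => E.
rewrite ler_pdivlMr //.
have := normc_expi_sub1 t1; set D := Normc.normc _ in E * => h.
have S0 : 0 <= S by exact: normc_ge0.
nra.
Qed.

(** * Digit tuples and the loss of one digit per block *)

(** Nested pairs instead of dependent functions: sums over tuples then factor by induction on the
    length. *)
Fixpoint digits (L : nat -> nat) (n : nat) : finType :=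
  if n is m.+1 then (digits L m * 'I_(L m))%type else unit.

Fixpoint digit (L : nat -> nat) (n : nat) : digits L n -> nat -> nat :=
  if n is m.+1 then fun f i => if i == m then f.2 : nat else digit f.1 i
  else fun _ _ => 0%N.

Lemma card_digits (L : nat -> nat) (n : nat) :
  #|digits L n| = (\prod_(i < n) L i)%N.
Proof.
elim: n => [|n IHn] /=; first by rewrite big_ord0 card_unit.
by rewrite card_prod IHn card_ord big_ord_recr.
Qed.

Lemma digit_lt (L : nat -> nat) (n i : nat) (f : digits L n) :
  (forall j, 0 < L j)%N -> (digit f i < L i)%N.
Proof.
move=> L0; elim: n f => [|n IHn] f //=.
by case: eqP => [->|_]; [exact: ltn_ord | exact: IHn].
Qed.

Lemma sum_digits {R : comPzSemiRingType} (L : nat -> nat) (n : nat)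
    (F : nat -> nat -> R) :
  \sum_(f : digits L n) \prod_(i < n) F i (digit f i) =
  \prod_(i < n) \sum_(d < L i) F i d.
Proof.
elim: n => [|n IHn].
  by rewrite big_ord0 (big_pred1 tt) ?big_ord0 //; case.
rewrite big_ord_recr /= -IHn big_distrlr /= pair_bigA /=.
apply: eq_bigr => f _; rewrite big_ord_recr /= eqxx; congr (_ * _).
by apply: eq_bigr => i _; rewrite ltn_eqF.
Qed.

(** The erased index comes with a full tuple, its own digit included. This keeps the type a product,
    so a uniform element has an erased index independent of its digits. *)
Definition masked (L : nat -> nat) (N : nat) : finType :=
  ('I_N * digits L N)%type.

Definition mdigit (L : nat -> nat) (N : nat) (t : masked L N) (i : nat) : nat :=
  if i == t.1 then 0%N else digit t.2 i.

Lemma mdigit_lt (L : nat -> nat) (N i : nat) (t : masked L N) :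
  (forall j, 0 < L j)%N -> (mdigit t i < L i)%N.
Proof. by move=> L0; rewrite /mdigit; case: ifP => _ //; exact: digit_lt. Qed.

(** For a fixed erased index the sum factors over the digits. If that index is [i0], one case in
    [N], only the trivial bound is left; otherwise the factor of [i0] saves [delta]. *)
Lemma masked_expi_le {R : realType} (L : nat -> nat) (N i0 : nat)
    (w : nat -> R) (delta : R) :
  (i0 < N)%N ->
  Normc.normc (\sum_(d < L i0) expi (w i0 *+ d)) <= delta * (L i0)%:R ->
  Normc.normc (\sum_(t : masked L N) expi (\sum_(i < N) w i *+ mdigit t i))
    <= (N%:R^-1 + delta) * #|masked L N|%:R.
Proof.
move=> iN hD.
(* The summand of digit [d] at index [i] when [j] is erased. At [i = j] it is 1 for every [d], since
   the erased digit is still summed over. *)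
pose G (j i d : nat) : R[i] := if i == j then 1 else expi (w i *+ d).
have -> : \sum_(t : masked L N) expi (\sum_(i < N) w i *+ mdigit t i) =
    \sum_(j < N) \prod_(i < N) \sum_(d < L i) G j i d.
  under [RHS]eq_bigr do rewrite -sum_digits.
  rewrite pair_bigA; apply: eq_bigr => t _ /=.
  rewrite (expi_sum _ (fun i => w i *+ mdigit t i)).
  apply: eq_bigr => i _; rewrite /G /mdigit.
  by case: ifP => // _; rewrite mulr0n expi0.
have G1 j i : Normc.normc (\sum_(d < L i) G j i d) <= (L i)%:R.
  apply: le_trans (normc_sum_le _) _.
  have -> : (L i)%:R = \sum_(d < L i) (1 : R) by rewrite sumr_const card_ord.
  apply: ler_sum => d _; rewrite /G; case: ifP => _.
    by rewrite Normc.normc1.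
  by rewrite normc_expi.
have d0 : 0 <= delta * (L i0)%:R by exact: le_trans (normc_ge0 _) hD.
set P : R := #|digits L N|%:R.
have PE : P = \prod_(i < N) (L i)%:R by rewrite /P card_digits natr_prod.
have D0 : 0 <= delta * P.
  by rewrite PE (bigD1 (Ordinal iN)) //= mulrA mulr_ge0 // prodr_ge0.
(* For [j = i0] the second term is mere slack; it makes the bound uniform in [j]. *)
have hj (j : 'I_N) : Normc.normc (\prod_(i < N) \sum_(d < L i) G j i d) <=
    (j == i0 :> nat)%:R * P + delta * P.
  rewrite normc_prod; have [ji|ji] := eqVneq (j : nat) i0.
    rewrite mul1r -[leLHS]addr0 lerD //.
    by rewrite PE; apply: ler_prod => i _; rewrite normc_ge0 G1.
  rewrite mul0r add0r PE (bigD1 (Ordinal iN)) //= [leRHS]mulrC.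
  rewrite [X in _ <= X * _](bigD1 (Ordinal iN)) //= mulrAC [_ * delta]mulrC.
  apply: ler_pM; rewrite ?normc_ge0 //.
  - by apply: prodr_ge0 => i _; exact: normc_ge0.
  - by move: hD; rewrite /G eq_sym (negbTE ji).
  - by apply: ler_prod => i _; rewrite normc_ge0 G1.
apply: le_trans (normc_sum_le _) _.
apply: le_trans (ler_sum _ (fun j _ => hj j)) _.
rewrite big_split /= sumr_const card_ord.
have -> : \sum_(j < N) (j == i0 :> nat)%:R * P = P.
  rewrite (bigD1 (Ordinal iN)) //= eqxx mul1r big1 ?addr0 // => j.
  by rewrite -val_eqE /= => /negbTE ->; rewrite mul0r.
have N0 : N%:R != 0 :> R by rewrite pnatr_eq0 -lt0n (leq_ltn_trans _ iN).
rewrite card_prod card_ord natrM -/P -[_ *+ N]mulr_natr le_eqVlt.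
by apply/orP; left; apply/eqP; field.
Qed.

(** * Equal cells of the unit interval under the uniform law *)

(* The index of the interval [m/P, (m+1)/P[ of [0, 1[ that contains [w]; the
   value outside [0, 1[ is irrelevant. *)
Definition cell {R : realType} (P : nat) (w : R) : nat :=
  if 0 <= w < 1 then Num.truncn (w * P%:R) else 0%N.

Lemma cell_lt {R : realType} (P : nat) (w : R) : (0 < P)%N -> (cell P w < P)%N.
Proof.
move=> P0; rewrite /cell; case: ifP => // /andP[w0 w1].
by rewrite truncn_lt_nat ?mulr_ge0 // gtr_pMl ?ltr0n.
Qed.

(** Dividing each cell into [C] equal parts refines the partition, so the coarse index is the fine
    one divided by [C]. Outside [0, 1[ both indices are 0. *)
Lemma cell_mul {R : realType} (P C : nat) (w : R) :
  (0 < C)%N -> (cell (P * C) w %/ C)%N = cell P w.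
Proof.
move=> C0; rewrite /cell; case: ifP => [/andP[w0 _]|_]; last by rewrite div0n.
have x0 : 0 <= w * P%:R by rewrite mulr_ge0.
have C0' : 0 < C%:R :> R by rewrite ltr0n.
apply/esym/truncn_def; set m := Num.truncn _.
have /andP[m1 m2] : m%:R <= w * (P * C)%:R < m.+1%:R.
  by apply: truncn_itv; rewrite mulr_ge0.
rewrite natrM mulrA in m1 m2.
apply/andP; split.
  rewrite -(ler_pM2r C0') -natrM (le_trans _ m1) // ler_nat.
  exact: leq_divM.
rewrite -(ltr_pM2r C0') -natrM (lt_le_trans m2) // ler_nat.
by rewrite ltn_ceil.
Qed.

Lemma cell_setE {R : realType} (P m : nat) : (0 < P)%N ->
  [set w : R | cell P w = m] `&` `[0, 1[ =
  if (m < P)%N then `[m%:R / P%:R, m.+1%:R / P%:R[%classic else set0.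
Proof.
move=> P0; have P0' : 0 < P%:R :> R by rewrite ltr0n.
have [mP|Pm] := ltnP m P; last first.
  apply/seteqP; split => // w /= [E _].
  by have := cell_lt w P0; rewrite E ltnNge Pm.
apply/seteqP; split => w /=; rewrite !in_itv /= ?ler_pdivrMr ?ltr_pdivlMr //.
  move=> [+ /[dup] w01 /andP[w0 _]]; rewrite /cell w01 => <-.
  by apply: truncn_itv; rewrite mulr_ge0.
move=> /[dup] h /andP[h1 h2].
have w0 : 0 <= w by rewrite -(pmulr_lge0 _ P0') (le_trans _ h1).
have w1 : w < 1.
  by rewrite -(ltr_pM2r P0') mul1r (lt_le_trans h2) // ler_nat.
by rewrite /cell w0 w1; split => //; exact: truncn_def.
Qed.

Lemma measurable_cell {R : realType} (P m : nat) : (0 < P)%N ->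
  measurable [set w : measurableTypeR R | cell P w = m].
Proof.
move=> P0; rewrite -[X in measurable X]setIT -(setUv `[0, 1[%classic) setIUr.
apply: measurableU.
  by rewrite (cell_setE _ P0); case: ifP.
have [m0|m0] := eqVneq m 0%N.
  rewrite (_ : _ `&` _ = ~` `[0, 1[%classic); first exact: measurableC.
  apply/seteqP; split => w /= => [[]//|]; rewrite in_itv /= => /negP/negbTE w01.
  by rewrite /cell w01 m0.
rewrite (_ : _ `&` _ = set0) //; apply/seteqP; split => w //= [].
rewrite in_itv /= => E /negP/negbTE w01; move: E; rewrite /cell w01 => E.
by rewrite -E eqxx in m0.
Qed.

Lemma uniform_cell {R : realType} (P m : nat) : (m < P)%N ->
  uniform_prob (@ltr01 R) [set w | cell P w = m] = (P%:R^-1)%:E.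
Proof.
move=> mP; have P0 : (0 < P)%N by exact: leq_ltn_trans mP.
have P0' : 0 < P%:R :> R by rewrite ltr0n.
have mA := @measurable_cell R _ m P0; set A := [set w | _] in mA *.
have mI : measurable_fun [set: measurableTypeR R] (fun x => (\1_A x : R)%:E).
  exact/measurable_EFinP/measurable_indic.
rewrite -[A]setIT -integral_indic // integral_uniform //.
(* The uniform law is carried by the closed interval. Its endpoint 1 falls in cell 0 by default, but
   it is a null set and is dropped here. *)
rewrite subr0 invr1 mul1e -integral_itv_bndo_bndc; last exact: measurable_funTS.
rewrite integral_indic // (cell_setE _ P0) mP.
etransitivity; first exact: (lebesgue_measure_itv `[m%:R / P%:R, m.+1%:R / P%:R[).
rewrite /= lte_fin.
rewrite ltr_pM2r ?invr_gt0 // ltr_nat leqnn -EFinD -mulrBl -natrB //.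
by rewrite subSnn mul1r.
Qed.

Lemma Rintegral_cell {R : realType} (P : nat) (h : nat -> R) : (0 < P)%N ->
  Rintegral (uniform_prob (@ltr01 R)) setT (fun w => h (cell P w)) =
  P%:R^-1 * \sum_(m < P) h m.
Proof.
move=> P0.
pose A m : set (measurableTypeR R) := [set w | cell P w = m].
have mA m : measurable (A m) by exact: measurable_cell.
have -> : (fun w => h (cell P w)) =
    (fun w : measurableTypeR R => \sum_(m < P) (h m * \1_(A m) w)).
  apply/funext => w.
  rewrite (bigD1 (Ordinal (cell_lt w P0))) //= indicE mem_set // mulr1.
  rewrite big1 ?addr0 // => i ni; rewrite indicE memNset ?mulr0 //.
  by move=> E; move: ni; rewrite -val_eqE /= -E eqxx.
have i1 m : (uniform_prob (@ltr01 R)).-integrable setT (EFin \o \1_(A m)).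
  apply: measurable_bounded_integrable => //.
  - by have /= -> := @probability_setT _ _ _ (uniform_prob (@ltr01 R)); rewrite ltry.
  - exists 1; split => // M M1 w _ /=; rewrite indicE.
    by case: (_ \in _); rewrite ?normr1 ?normr0 ltW // (lt_trans ltr01).
have iA m : (uniform_prob (@ltr01 R)).-integrable setT
    (fun w => (h m * \1_(A m) w)%:E).
  exact: (integrableZl measurableT (h m) (i1 m)).
rewrite /Rintegral.
under eq_integral do rewrite -sumEFin.
have -> := integral_sum measurableT (fun i : 'I_P => iA i) (index_enum _) xpredT.
rewrite mulr_sumr -[RHS]/(fine (_)%:E) -sumEFin.
congr fine; apply: eq_bigr => m _.
rewrite (_ : (fun w => (h m * \1_(A m) w)%:E) =
   (fun w : measurableTypeR R => (h m)%:E * (\1_(A m) w)%:E)%E) //.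
rewrite (integralZl measurableT (i1 m)).
rewrite integral_indic // setIT; have /= -> := @uniform_cell R _ _ (ltn_ord m).
by rewrite -EFinM mulrC.
Qed.

Lemma measurable_cell_comp {R : realType} (P : nat) (h : nat -> R) : (0 < P)%N ->
  measurable_fun [set: measurableTypeR R] (fun w => h (cell P w)).
Proof.
move=> P0 _ B mB; rewrite setTI.
rewrite (_ : _ @^-1` _ =
  \bigcup_(m in [set m | B (h m)]) [set w | cell P w = m]); last first.
  by apply/seteqP; split => [w Bw|w [m /= Bm]] /=; [exists (cell P w) | move=> ->].
by apply: bigcup_measurable => m _; exact: measurable_cell.
Qed.

(** * Mixed-radix digits of a uniform number and their independence *)

Lemma sum_divn_modn {V : nmodType} (P C : nat) (F : nat -> nat -> V) : (0 < C)%N ->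
  \sum_(m < P * C) F (m %/ C)%N (m %% C)%N = \sum_(a < P) \sum_(d < C) F a d.
Proof.
move=> C0.
rewrite -(big_mkord xpredT (fun m => F (m %/ C)%N (m %% C)%N)) big_nat_mul.
rewrite big_mkord; apply: eq_bigr => a _.
rewrite -{1}[(a * C)%N]add0n big_addn mulSn addnK big_mkord.
by apply: eq_bigr => d _; rewrite addnC divnMDl // divn_small // addn0 modnMDl modn_small.
Qed.

Definition radix (C : nat -> nat) (n : nat) : nat := (\prod_(k < n) C k)%N.

Lemma radixS (C : nat -> nat) (n : nat) : radix C n.+1 = (radix C n * C n)%N.
Proof. by rewrite /radix big_ord_recr. Qed.

Lemma radix_gt0 (C : nat -> nat) (n : nat) :
  (forall k, 0 < C k)%N -> (0 < radix C n)%N.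
Proof. by move=> C0; rewrite /radix prodn_gt0. Qed.

Definition cdigit {R : realType} (C : nat -> nat) (k : nat) (w : R) : nat :=
  (cell (radix C k.+1) w %% C k)%N.

(* The term [v k] evaluated at the digits of [m] in the mixed radix [C], the last
   digit being the one of index [n.-1]. *)
Fixpoint nat_sum {V : nmodType} (C : nat -> nat) (v : nat -> nat -> V)
    (n m : nat) : V :=
  if n is k.+1 then nat_sum C v k (m %/ C k)%N + v k (m %% C k)%N else 0.

(** By [cell_mul], all of the first [n] digits are read off one integer, the cell at level [n];
    integrals thereby become finite sums. *)
Lemma sum_cdigit {R : realType} {V : nmodType} (C : nat -> nat)
    (v : nat -> nat -> V) (n : nat) (w : R) : (forall k, 0 < C k)%N ->
  \sum_(k < n) v k (cdigit C k w) = nat_sum C v n (cell (radix C n) w).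
Proof.
move=> C0; elim: n => [|n IHn]; first by rewrite big_ord0.
by rewrite big_ord_recr /= IHn /cdigit radixS cell_mul.
Qed.

Lemma sum_expi_nat_sum {R : realType} (C : nat -> nat) (v : nat -> nat -> R)
    (n : nat) : (forall k, 0 < C k)%N ->
  \sum_(m < radix C n) expi (nat_sum C v n m) =
  \prod_(k < n) \sum_(d < C k) expi (v k d).
Proof.
move=> C0; elim: n => [|n IHn].
  by rewrite big_ord0 /radix big_ord0 big_ord1 expi0.
rewrite big_ord_recr /= -IHn radixS.
rewrite (sum_divn_modn _ (fun a d => expi (nat_sum C v n a + v n d))) //.
rewrite big_distrlr /=; apply: eq_bigr => a _; apply: eq_bigr => d _.
by rewrite expiD.
Qed.

(** Independence of the digits: the integral is an average over the [radix C n] cells, and Euclidean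
    division splits that sum into a product. *)
Lemma normc_cintegral_cdigit {R : realType} (C : nat -> nat)
    (v : nat -> nat -> R) (n : nat) : (forall k, 0 < C k)%N ->
  Normc.normc (cintegral (uniform_prob (@ltr01 R))
    (fun w => expi (\sum_(k < n) v k (cdigit C k w)))) =
  \prod_(k < n) (Normc.normc (\sum_(d < C k) expi (v k d)) / (C k)%:R).
Proof.
move=> C0; have P0 := radix_gt0 n C0.
have -> : cintegral (uniform_prob (@ltr01 R))
    (fun w => expi (\sum_(k < n) v k (cdigit C k w))) =
    ((radix C n)%:R^-1)%:C * \sum_(m < radix C n) expi (nat_sum C v n m).
  under eq_fun do rewrite (sum_cdigit v n _ C0).
  rewrite /cintegral.
  rewrite (Rintegral_cell (fun m => complex.Re (expi (nat_sum C v n m)))) //.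
  rewrite (Rintegral_cell (fun m => complex.Im (expi (nat_sum C v n m)))) //.
  have -> : \sum_(m < radix C n) expi (nat_sum C v n m) =
    (\sum_(m < radix C n) complex.Re (expi (nat_sum C v n m))) +i*
    (\sum_(m < radix C n) complex.Im (expi (nat_sum C v n m))).
    have hRe : {morph (@complex.Re R) : x y / x + y} by case=> a b [].
    have hIm : {morph (@complex.Im R) : x y / x + y} by case=> a b [].
    apply/eqP; rewrite eq_complex /= (big_morph _ hRe (erefl _)).
    by rewrite (big_morph _ hIm (erefl _)) !eqxx.
  by apply/eqP; rewrite eq_complex /= !mul0r subr0 addr0 !eqxx.
rewrite Normc.normcM sum_expi_nat_sum // normc_prod prodf_div mulrC; congr (_ * _).
rewrite /Normc.normc /= expr0n /= addr0 sqrtr_sqr ger0_norm ?invr_ge0 //.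
by rewrite /radix natr_prod.
Qed.

(** * The law of a random series with independent terms *)

Lemma normc_cintegral_lim {R : realType}
    (P : probability (measurableTypeR R) R)
    (Y : nat -> R -> R) (X : R -> R) (c : R) (N : nat) :
  (forall n, measurable_fun [set: measurableTypeR R] (Y n)) ->
  (forall w, Y n w @[n --> \oo] --> X w) ->
  (forall n, (N <= n)%N ->
     Normc.normc (cintegral P (fun w => expi (Y n w))) <= c) ->
  Normc.normc (cintegral P (fun w => expi (X w))) <= c.
Proof.
move=> mY YX hc.
have mX : measurable_fun [set: measurableTypeR R] X.
  by apply: (measurable_fun_cvg mY) => w _; exact: YX.
have cvgR (f : R -> R) : continuous f -> (forall x, `|f x| <= 1) ->
    Rintegral P setT (fun w => f (Y n w)) @[n --> \oo] -->
    Rintegral P setT (fun w => f (X w)).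
  move=> cf f1.
  have mf : measurable_fun [set: measurableTypeR R] f.
    exact: continuous_measurable_fun.
  have i1 : P.-integrable setT (EFin \o cst 1).
    exact: finite_measure_integrable_cst.
  have mfY n : measurable_fun setT (fun w : measurableTypeR R => (f (Y n w))%:E).
    by apply/measurable_EFinP; exact: measurableT_comp mf (mY n).
  have mfX : measurable_fun setT (fun w : measurableTypeR R => (f (X w))%:E).
    by apply/measurable_EFinP; exact: measurableT_comp mf mX.
  have [||iX _] := @dominated_convergence _ _ _ P setT measurableT
      (fun n w => (f (Y n w))%:E) (fun w => (f (X w))%:E) (EFin \o cst 1)
      mfY mfX _ i1.
  - apply: aeW => w _; apply: cvg_EFin; first exact: nearW.
    by apply: continuous_cvg; [exact: cf | exact: YX].
  - by apply: aeW => w n _; rewrite /= lee_fin.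
  rewrite -[X in _ --> X]fineK; last exact: integrable_fin_num.
  exact: fine_cvg.
have c0 : 0 <= c by exact: le_trans (normc_ge0 _) (hc N (leqnn N)).
have hcos := cvgR _ (@continuous_cos R) (@cos_max R).
have hsin := cvgR _ (@continuous_sin R) (@sin_max R).
have hq := cvgD (cvgM hcos hcos) (cvgM hsin hsin).
(* Squaring removes the root from the modulus. Dominated convergence then gives the limit of the two
   squares, and the bound is a closed condition. *)
rewrite /cintegral /expi /= -(ler_sqr) ?nnegrE ?sqrtr_ge0 //.
rewrite sqr_sqrtr ?addr_ge0 ?sqr_ge0 // !expr2.
apply: (closed_cvg (fun x : R => x <= c * c) (@closed_le _ _) _ _ (hq _ _ _)).
exists N => // n /= Nn; have := hc n Nn.
rewrite /cintegral /expi /= -(ler_sqr) ?nnegrE ?sqrtr_ge0 //.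
by rewrite sqr_sqrtr ?addr_ge0 ?sqr_ge0 // !expr2.
Qed.

Lemma bounded_monotone_lim {R : realType} (u : nat -> R) (B : R) :
  (forall n, 0 <= u n) -> (forall n, \sum_(k < n) u k <= B) ->
  cvgn (fun n => \sum_(k < n) u k).
Proof.
move=> u0 uB; apply: nondecreasing_is_cvgn.
  apply/nondecreasing_seqP => n; rewrite big_ord_recr /= lerDl; exact: u0.
by exists B => _ [n _ <-]; exact: uB.
Qed.

(* [mu] is the law of a series of independent terms [v k t] with [t] uniform in
   [T k]; the terms are read off the mixed-radix digits of a uniform number. *)
Lemma random_series {R : realType} (T : nat -> finType)
    (v : forall k, T k -> R) (B : R) :
  (forall k, 0 < #|T k|)%N -> (forall k t, 0 <= v k t) ->
  (forall (t : forall k, T k) n, \sum_(k < n) v k (t k) <= B) ->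
  exists mu : {finite_measure set (measurableTypeR R) -> \bar R},
  [/\ mu setT <> 0%E,
     forall A : set (measurableTypeR R), measurable A ->
       (forall (t : forall k, T k) x,
          \sum_(k < n) v k (t k) @[n --> \oo] --> x -> A x) ->
       mu (~` A) = 0%E
   & forall xi k, Normc.normc (fourier mu xi) <=
       Normc.normc (\sum_(t : T k) expi (- (2 * pi * xi) * v k t)) / #|T k|%:R].
Proof.
move=> T0 v0 vB.
pose C k := #|T k|.
pose t (w : R) k : T k := enum_val (Ordinal (ltn_pmod (cell (radix C k.+1) w) (T0 k))).
(* The terms as functions of natural digits. The default 0 is never reached, as digit [k] is below
   the cardinal of [T k]. *)
pose v' k d : R := if insub d is Some i then v k (enum_val (i : 'I_#|T k|)) else 0.
have v'E k w : v' k (cdigit C k w) = v k (t w k).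
  rewrite /v' /t; case: insubP => [i _ /= iE|]; last first.
    by rewrite /cdigit (ltn_pmod _ (T0 k)).
  by congr (v k (enum_val _)); exact: val_inj.
pose Y n w : R := \sum_(k < n) v k (t w k).
pose X w : R := limn (fun n => Y n w).
have YX w : Y n w @[n --> \oo] --> X w.
  exact: (@bounded_monotone_lim _ (fun k => v k (t w k)) B _ (vB (t w))).
have mY n : measurable_fun [set: measurableTypeR R] (Y n).
  rewrite (_ : Y n = fun w => nat_sum C v' n (cell (radix C n) w)).
    by apply: measurable_cell_comp; exact: radix_gt0.
  apply/funext => w; rewrite -sum_cdigit //.
  by apply: eq_bigr => k _; rewrite v'E.
have mX : measurable_fun [set: measurableTypeR R] X.
  by apply: (measurable_fun_cvg mY) => w _; exact: YX.
pose Xm : {mfun measurableTypeR R >-> measurableTypeR R} := 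
  @mfun_Sub _ _ (measurableTypeR R) (measurableTypeR R) X (mem_set mX).
exists (distribution (uniform_prob (@ltr01 R)) Xm); split.
- have /= -> := @probability_setT _ _ _ (distribution (uniform_prob (@ltr01 R)) Xm).
  by apply/eqP; rewrite onee_neq0.
(* The series lies in [A] for every [w], not just almost every one, so the preimage of the
   complement is empty. *)
- move=> A mA hA; rewrite /= /distribution /pushforward /=.
  rewrite (_ : _ @^-1` _ = set0) ?measure0 //.
  by apply/seteqP; split => // w /=; apply; exact: hA (YX w).
- move=> xi k.
  pose s := - (2 * pi * xi).
  have -> : fourier (distribution (uniform_prob (@ltr01 R)) Xm) xi =
      cintegral (uniform_prob (@ltr01 R)) (fun w => expi (s * X w)).
    have hI (f : R -> R) : continuous f -> (forall x, `|f x| <= 1) ->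
        Rintegral (distribution (uniform_prob (@ltr01 R)) Xm) setT
          (fun x => f (- (2 * pi * x * xi))) =
        Rintegral (uniform_prob (@ltr01 R)) setT (fun w => f (s * X w)).
      move=> cf f1.
      have mg : measurable_fun [set: measurableTypeR R]
          (fun x => f (- (2 * pi * x * xi))).
        apply: (measurableT_comp (continuous_measurable_fun cf)).
        apply: continuous_measurable_fun.
        rewrite (_ : (fun x => _) = *%R s); first exact: mulrl_continuous.
        by apply/funext => x; rewrite /s; ring.
      rewrite /Rintegral integral_distribution /=.
      - congr fine; apply: eq_integral => w _ /=; congr (f _)%:E.
        by rewrite /s; ring.
      - exact/measurable_EFinP.
      - apply: measurable_bounded_integrable => //.
        + by have /= -> := @probability_setT _ _ _ (uniform_prob (@ltr01 R)); rewrite ltry.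
        + exact: measurableT_comp mg mX.
        + by exists 1; split => // M M1 w _ /=; rewrite (le_trans (f1 _)) // ltW.
    rewrite /fourier /cintegral /expi /=; congr (_ +i* _); apply: hI => //.
    - exact: continuous_cos.
    - exact: cos_max.
    - exact: continuous_sin.
    - exact: sin_max.
  (* From [k.+1] terms on, term [k] contributes its factor; every other factor is at most 1. *)
  apply: (@normc_cintegral_lim _ _ (fun n w => s * Y n w) _ _ k.+1).
  + by move=> n; exact: measurable_funM.
  + by move=> w; apply: cvgMr; exact: YX.
  + move=> n kn.
    under eq_fun do rewrite mulr_sumr.
    under eq_fun do under eq_bigr do rewrite -v'E.
    rewrite (normc_cintegral_cdigit (fun k d => s * v' k d)) //.
    have sumE j : \sum_(d < C j) expi (s * v' j d) = \sum_(t : T j) expi (s * v j t).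
      rewrite (reindex _ (onW_bij _ (@enum_val_bij (T j)))) /=; apply: eq_bigr => d _.
      by rewrite /v' valK.
    rewrite (bigD1 (Ordinal kn)) //= sumE -[leRHS]mulr1 ler_pM //.
    * by rewrite divr_ge0 ?normc_ge0.
    * by apply: prodr_ge0 => i _; rewrite divr_ge0 ?normc_ge0.
    * apply: prodr_ile1 => i _; rewrite divr_ge0 ?normc_ge0 //=.
      rewrite ler_pdivrMr ?ltr0n //; last exact: T0.
      rewrite mul1r (le_trans (normc_sum_le _)) //.
      under eq_bigr do rewrite normc_expi.
      by rewrite sumr_const card_ord.
Qed.

(** * The rapidly growing denominators *)

Lemma fast_sequence {R : realType} (psi : nat -> R) :
  (forall n, (1 <= n)%N -> 0 < psi n) ->
  exists q : nat -> nat, [/\ q 0%N = 1%N, forall l, (q l < q l.+1)%N,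
    forall l, (q l %| q l.+1)%N &
    forall l, (16 * l.+2)%:R / (q l.+1)%:R <= 2^-1 ^+ l.+1 * Num.min 1 (psi (q l))].
Proof.
move=> psi0.
(* The required inequality solved for [q l.+1]. In the minimum, 1 keeps the whole series bounded and
   [psi] controls its tails. *)
pose c (l a : nat) : R := (16 * l.+2)%:R * 2 ^+ l.+1 / Num.min 1 (psi a).
(* The two successors make the multiplier at least 2, hence [q] strictly increasing. *)
pose q := fix q (l : nat) : nat :=
  if l is m.+1 then (q m * (Num.truncn (c m (q m))).+2)%N else 1%N.
have q0 l : (0 < q l)%N by elim: l => //= l IHl; rewrite muln_gt0 IHl.
exists q; split => // l; first by rewrite /= ltn_Pmulr.
  exact: dvdn_mulr.
have m0 : 0 < Num.min 1 (psi (q l)) by rewrite lt_min ltr01 psi0 // q0.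
have Q0 : 0 < (q l.+1)%:R :> R by rewrite ltr0n.
have P0 : 0 < 2 ^+ l.+1 :> R by rewrite exprn_gt0.
have cq : c l (q l) <= (q l.+1)%:R.
  apply: le_trans (ltW (truncnS_gt _)) _; rewrite ler_nat /=.
  by rewrite (leq_trans (leqnSn _)) // leq_pmull.
move: cq; rewrite /c ler_pdivrMr // => cq.
rewrite ler_pdivrMr // exprVn -mulrA ler_pdivlMl //.
by rewrite mulrC [X in _ <= X]mulrC.
Qed.

(** * Indices grouped into blocks *)

(* Block [k] consists of the indices [start k + i] with [i <= k]; [block] is the
   inverse of [(k, i) |-> start k + i]. *)
Definition start (k : nat) : nat := (\sum_(j < k) j.+1)%N.

Lemma startS (k : nat) : start k.+1 = (start k + k.+1)%N.
Proof. by rewrite /start big_ord_recr. Qed.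

Lemma leq_start (k l : nat) : (k <= l)%N -> (start k <= start l)%N.
Proof.
move=> kl; rewrite -(subnKC kl); elim: (l - k)%N => [|m IHm]; first by rewrite addn0.
by rewrite addnS startS (leq_trans IHm) // leq_addr.
Qed.

Lemma start_ge (k : nat) : (k <= start k)%N.
Proof. by elim: k => // k IHk; rewrite startS; lia. Qed.

Fixpoint block (l : nat) : nat * nat :=
  if l is m.+1 then
    let: (k, i) := block m in if (i < k)%N then (k, i.+1) else (k.+1, 0%N)
  else (0%N, 0%N).

Lemma blockP (l : nat) :
  ((block l).2 <= (block l).1)%N /\ l = (start (block l).1 + (block l).2)%N.
Proof.
elim: l => [|l]; first by rewrite /start /= big_ord0.
rewrite /=; case: (block l) => k i /= [ik ->].
case: ltnP => ki /=; rewrite ?startS; lia.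
Qed.

Lemma blockE (k i : nat) : (i <= k)%N -> block (start k + i) = (k, i).
Proof.
elim: k i => [|k IHk] i; first by rewrite leqn0 => /eqP ->; rewrite /start big_ord0.
elim: i => [_|i IHi ik].
  by rewrite addn0 startS addnS /= IHk // ltnn.
by rewrite addnS /= IHi ?(ltnW ik) //; case: ltnP => //; lia.
Qed.

Lemma sum_blocks {V : nmodType} (u : nat -> V) (n : nat) :
  \sum_(k < n) \sum_(i < k.+1) u (start k + i)%N = \sum_(l < start n) u l.
Proof.
elim: n => [|n IHn]; first by rewrite /start !big_ord0.
rewrite big_ord_recr IHn -!(big_mkord xpredT) startS /=.
rewrite [RHS](@big_cat_nat _ _ _ (start n)) ?leq_addr //=; congr (_ + _).
rewrite -{2}[start n]add0n big_addn addKn.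
by rewrite big_mkord; apply: eq_bigr => i _; rewrite addnC.
Qed.

(** * Deterministic estimates for one realization *)

(* [d] is the sequence of digits of one realization of the random series, with
   the erased digits already replaced by 0. *)
Section SeriesTerms.
Context {R : realType} (psi : nat -> R) (q d : nat -> nat).
Hypothesis psi_gt0 : forall n, (1 <= n)%N -> 0 < psi n.
Hypothesis psi_decr : forall m n, (1 <= m)%N -> (m <= n)%N -> psi n <= psi m.
Hypothesis q0 : q 0%N = 1%N.
Hypothesis q_lt : forall l, (q l < q l.+1)%N.
Hypothesis q_dvd : forall l, (q l %| q l.+1)%N.
Hypothesis q_fast : forall l,
  (16 * l.+2)%:R / (q l.+1)%:R <= 2^-1 ^+ l.+1 * Num.min 1 (psi (q l)).
Hypothesis d_lt : forall l, (d l < 16 * l.+1 * (q l.+1 %/ q l))%N.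

Let u (l : nat) : R := (q l.+1)%:R^-1 *+ d l.

Lemma q_homo (l m : nat) : (l <= m)%N -> (q l <= q m)%N.
Proof.
move=> lm; rewrite -(subnKC lm); elim: (m - l)%N => [|n IHn]; first by rewrite addn0.
by rewrite addnS (leq_trans IHn) // ltnW.
Qed.

Lemma q_ge (l : nat) : (l < q l)%N.
Proof. by elim: l => [|l IHl]; rewrite ?q0 // (leq_ltn_trans IHl). Qed.

Let q_gt0 l : 0 < (q l)%:R :> R.
Proof. by rewrite ltr0n (leq_ltn_trans _ (q_ge l)). Qed.

Let u_ge0 l : 0 <= u l.
Proof. by rewrite mulrn_wge0 // invr_ge0 ltW. Qed.

Let u_le l : u l <= (16 * l.+1)%:R / (q l)%:R.
Proof.
rewrite /u -[_ *+ d l]mulr_natl ler_pdivrMr // mulrAC ler_pdivlMr // -!natrM ler_nat.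
rewrite -(divnK (q_dvd l)) mulnA leq_mul2r orbC ltnW //.
Qed.

Let uS_le l : u l.+1 <= 2^-1 ^+ l.+1 * Num.min 1 (psi (q l)).
Proof. exact: le_trans (u_le _) (q_fast _). Qed.

Lemma partial_sum_le (n : nat) : \sum_(l < n) u l <= 17.
Proof.
case: n => [|n]; first by rewrite big_ord0.
apply: (@le_trans _ _ (17 - 2^-1 ^+ n)); last by rewrite gerBl exprn_ge0.
elim: n => [|n IHn].
  rewrite big_ord1 (le_trans (u_le _)) // q0 muln1 divr1 expr0.
  by rewrite -[X in _ <= _ - X]/(1%:R) -natrB.
rewrite big_ord_recr /=; have := uS_le n.
have : 2^-1 ^+ n.+1 * Num.min 1 (psi (q n)) <= 2^-1 ^+ n.+1.
  by rewrite ler_piMr ?exprn_ge0 // ge_min lexx.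
have : 2^-1 ^+ n.+1 = 2^-1 * 2^-1 ^+ n :> R by rewrite exprS.
by move: IHn; set x := _ ^+ n; set y := _ ^+ n.+1; lra.
Qed.

(** All denominators so far divide [q n]. The bound on [p] leaves finitely many candidate fractions,
    as closedness of [gap_set] requires. *)
Lemma partial_sum_rat (n : nat) :
  exists2 p : nat, (p <= 17 * q n)%N & \sum_(l < n) u l = p%:R / (q n)%:R.
Proof.
have [p pE] : exists p : nat, \sum_(l < n) u l = p%:R / (q n)%:R.
  elim: n => [|n [p pE]]; first by exists 0%N; rewrite big_ord0 mul0r.
  exists (p * (q n.+1 %/ q n) + d n)%N.
  rewrite big_ord_recr /= pE /u -[_ *+ d n]mulr_natl natrD mulrDl; congr (_ + _).
  rewrite -[in (q n.+1)%:R](divnK (q_dvd n)) !natrM.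
  have r0 : (q n.+1 %/ q n)%:R != 0 :> R.
    by rewrite pnatr_eq0 -lt0n divn_gt0 ?q_homo // (leq_ltn_trans _ (q_ge n)).
  by field; rewrite r0 gt_eqF.
exists p => //; rewrite -(@ler_nat R) natrM -ler_pdivrMr // -pE.
exact: partial_sum_le.
Qed.

Lemma partial_sum_gap (i n : nat) : d i = 0%N -> (i < n)%N ->
  \sum_(l < i) u l <= \sum_(l < n) u l <= \sum_(l < i) u l + psi (q i).
Proof.
move=> di lt_in; rewrite -(subnKC lt_in); set m := (n - i.+1)%N.
have psi0 : 0 < psi (q i) by rewrite psi_gt0 // (leq_ltn_trans _ (q_ge i)).
(* Term [i] vanishes and the later ones decay geometrically from [psi (q i) / 2]; the factor
   [1 - 2^-m] records the share spent by [m] of them. *)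
suff : \sum_(l < i) u l <= \sum_(l < i.+1 + m) u l <=
    \sum_(l < i) u l + psi (q i) * (1 - 2^-1 ^+ m).
  move=> /andP[-> h]; rewrite (le_trans h) // lerD2l.
  by apply: ler_piMr; [exact: ltW | rewrite gerBl exprn_ge0].
elim: m => [|m /andP[IH1 IH2]].
  by rewrite addn0 big_ord_recr /= /u di mulr0n addr0 expr0 subrr mulr0 addr0 lexx.
rewrite addnS big_ord_recr /= (le_trans IH1) ?lerDl ?u_ge0 //=.
(* [q_fast] gives a bound by [psi] at [q (i + m)], which is at most [psi (q i)] by monotonicity. *)
have h : u (i.+1 + m) <= 2^-1 ^+ m.+1 * psi (q i).
  rewrite addSn (le_trans (uS_le _)) //.
  apply: ler_pM; rewrite ?exprn_ge0 //.
  - by rewrite le_min ler01 ltW // psi_gt0 // (leq_ltn_trans _ (q_ge _)).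
  - rewrite -addnS exprD ler_piMl ?exprn_ge0 // exprn_ile1 // invf_le1 //.
    by rewrite ler1n.
  - rewrite ge_min psi_decr ?orbT // ?(leq_ltn_trans _ (q_ge _)) //.
    by rewrite q_homo // leq_addr.
have : 2^-1 ^+ m.+1 = 2^-1 * 2^-1 ^+ m :> R by rewrite exprS.
move: h IH2; set x := _ ^+ m; set y := _ ^+ m.+1 => h IH2 yE.
rewrite yE in h *; nra.
Qed.

End SeriesTerms.

(** * The compact set carrying the measure *)

(** Both unions are finite, so the set is closed. The intervals extend only to the right of the
    fractions because a truncated sum lies below the full one. *)
Definition gap_set {R : realType} (psi : nat -> R) (q : nat -> nat) : set R :=
  `[0, 17] `&` \bigcap_(k in [set: nat])
    \bigcup_(i in `I_k.+1) \bigcup_(p in `I_(17 * q (start k + i)).+1)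
      `[p%:R / (q (start k + i)%N)%:R,
        p%:R / (q (start k + i)%N)%:R + psi (q (start k + i)%N)]%classic.

Lemma compact_gap_set {R : realType} (psi : nat -> R) (q : nat -> nat) :
  compact (gap_set psi q).
Proof.
rewrite /gap_set; apply: compact_closedI; first exact: segment_compact.
apply: closed_bigI => k _; apply: closed_bigcup => [|i _].
  exact: finite_II.
apply: closed_bigcup => [|p _]; first exact: finite_II.
exact: interval_closed.
Qed.

(** Finitely many pairs would have denominators below some [N], but block [N] supplies an
    approximation whose denominator is at least [N]. *)
Lemma gap_set_well_approximable {R : realType} (psi : nat -> R) (q : nat -> nat) :
  (forall l, (l < q l)%N) -> gap_set psi q `<=` well_approximable psi.
Proof.
move=> q_ge x [_ xK]; rewrite /well_approximable /= => finA.
have [N hN] : exists N, forall pq : int * nat,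
    (1 <= pq.2)%N /\ `|x - pq.1%:~R / pq.2%:R| <= psi pq.2 -> (pq.2 < N)%N.
  move/finite_seqP: finA => [A AE].
  exists (\sum_(pq <- A) pq.2)%N.+1 => pq pqA.
  have {}pqA : pq \in A by have : [set` A] pq by rewrite -AE.
  by rewrite ltnS (big_rem _ pqA) /= leq_addr.
have [i _ [p _ /=]] := xK N I; set l := (start N + i)%N.
rewrite in_itv /= => /andP[x1 x2].
have qN : (N <= q l)%N.
  by rewrite (leq_trans _ (ltnW (q_ge l))) // (leq_trans (start_ge N)) // leq_addr.
suff : (q l < N)%N by rewrite ltnNge qN.
apply: (hN (p%:Z, q l)); split => /=; first exact: leq_ltn_trans (q_ge l).
by rewrite -pmulrn ger0_norm ?subr_ge0 // lerBlDr addrC.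
Qed.

(** * Construction of the measure, its Fourier decay and its support *)

Theorem theorem2p6 (R : realType) (psi : nat -> R)
    (psi_gt0 : forall q : nat, (1 <= q)%N -> 0 < psi q)
    (psi_decr : forall m n : nat, (1 <= m)%N -> (m <= n)%N -> psi n <= psi m) :
  exists (mu : {finite_measure set (measurableTypeR R) -> \bar R}) (K : set R),
    [/\ Rajchman mu, compact K, K `<=` well_approximable psi
      & supported_on mu K].
Proof.
have [q [q0 q_lt q_dvd q_fast]] := fast_sequence psi_gt0.
pose L l := (16 * l.+1 * (q l.+1 %/ q l))%N.
have q_gt l : (0 < q l)%N by exact: leq_ltn_trans (q_ge q0 q_lt l).
have r_gt0 l : (0 < q l.+1 %/ q l)%N.
  by rewrite divn_gt0 // ltnW.
have L_gt0 l : (0 < L l)%N by rewrite /L !muln_gt0 /= r_gt0.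
pose Lb k i := L (start k + i)%N.
pose T k : finType := masked (Lb k) k.+1.
pose v k (t : T k) : R :=
  \sum_(i < k.+1) ((q (start k + i).+1)%:R^-1 *+ mdigit t i).
(* The blocks spliced into a single digit sequence, to which the estimates for one realization
   apply. *)
pose d (t : forall k, T k) l := mdigit (t (block l).1) (block l).2.
have d_lt t l : (d t l < L l)%N.
  have [_ lE] := blockP l; rewrite [X in (_ < L X)%N]lE.
  by apply: (@mdigit_lt (Lb (block l).1) _ (block l).2) => j; exact: L_gt0.
pose S t n : R := \sum_(l < n) (q l.+1)%:R^-1 *+ d t l.
have vS (t : forall k, T k) n : \sum_(k < n) v k (t k) = S t (start n).
  rewrite /S -(sum_blocks (fun l => (q l.+1)%:R^-1 *+ d t l)).
  apply: eq_bigr => k _; apply: eq_bigr => i _.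
  by rewrite /d blockE // -ltnS.
have T_gt0 k : (0 < #|T k|)%N.
  rewrite card_prod card_ord card_digits muln_gt0 prodn_gt0 // => i; exact: L_gt0.
have v_ge0 k (t : T k) : 0 <= v k t.
  by rewrite /v; apply: sumr_ge0 => i _; rewrite mulrn_wge0 // invr_ge0 ler0n.
have S_le t n : S t n <= 17.
  exact: (partial_sum_le q0 q_lt q_dvd q_fast (d_lt t)).
have S_ge0 t n : 0 <= S t n.
  by rewrite /S; apply: sumr_ge0 => i _; rewrite mulrn_wge0 // invr_ge0 ler0n.
have v_le (t : forall k, T k) n : \sum_(k < n) v k (t k) <= 17 by rewrite vS.
have [mu [mu0 muK muF]] := random_series T_gt0 v_ge0 v_le.
exists mu, (gap_set psi q); split.
- split => // e e0.
  have [N hN] : exists N : nat, 2 / e < N.+1%:R.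
    by exists (Num.truncn (2 / e)); exact: truncnS_gt.
  (* Beyond this threshold the scale of [xi] has an index at least [start N], hence lies in a block
     [k >= N]. *)
  exists ((q (start N))%:R / 16) => xi xiN.
  have xi0 : 0 < `|xi| by apply: lt_le_trans xiN; rewrite divr_gt0 ?ltr0n.
  have [i [iN qi qiS]] : exists i, [/\ (start N <= i)%N,
      (q i)%:R <= 16 * `|xi| & 16 * `|xi| < (q i.+1)%:R].
    have q_homo := q_homo q_lt.
    have ex : exists i, 16 * `|xi| < (q i)%:R.
      exists (Num.truncn (16 * `|xi|)).+1.
      apply: lt_le_trans (truncnS_gt _) _.
      by rewrite ler_nat ltnW // (q_ge q0 q_lt).
    (* The least index with [q] above [16 |xi|] is not 0, as [q 0 = 1 <= 16 |xi|]; its predecessor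
       is the scale sought. *)
    case: (ex_minnP ex) => -[|i] hi mini.
      move: hi; rewrite q0 => hi; exfalso.
      have : 1 <= (q (start N))%:R :> R by rewrite ler1n.
      lra.
    exists i; split => //; last first.
      by rewrite leNgt; apply/negP => /mini; rewrite ltnn.
    rewrite leqNgt; apply/negP => /q_homo; rewrite -(ler_nat R) => hq.
    by move: xiN; rewrite ler_pdivrMr ?ltr0n // mulrC leNgt (lt_le_trans hi hq).
  have [ik iE] := blockP i.
  set k := (block i).1 in ik iE; set j := (block i).2 in ik iE.
  have Nk : (N <= k)%N.
    rewrite leqNgt; apply/negP => /leq_start; rewrite startS; lia.
  apply: (le_lt_trans (muF xi k)).
  rewrite ltr_pdivrMr ?ltr0n ?(T_gt0 k) //.
  set s := - (2 * pi * xi).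
  under eq_bigr do rewrite /v mulr_sumr.
  under eq_bigr do under eq_bigr do rewrite mulrnAr.
  (* The upper bound on [16 |xi|] and [pi < 4] give [|a| <= 1/2]; the lower one and [pi >= 2] give
     [4 / |a| <= L i / i.+1]. *)
  have h : Normc.normc (\sum_(d < Lb k j) expi (s * (q (start k + j).+1)%:R^-1 *+ d))
      <= i.+1%:R^-1 * (Lb k j)%:R.
    rewrite /Lb -iE; set a := s * _.
    have pi2 := @pi_ge2 R.
    have pi4 : pi < 4 :> R by have /andP[_] := @pihalf_02 R; lra.
    have Q0 : 0 < (q i.+1)%:R :> R by rewrite ltr0n.
    have aE : `|a| = 2 * pi * `|xi| / (q i.+1)%:R.
      rewrite /a /s normrM normrN !normrM (ger0_norm (pi_ge0 R)).
      by rewrite [`|_^-1|]ger0_norm ?invr_ge0 // [`|2|]ger0_norm.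
    have a0 : 0 < `|a| by rewrite aE !mulr_gt0 ?invr_gt0 ?pi_gt0.
    have a1 : `|a| <= 1 / 2.
      by rewrite aE ler_pdivrMr //; nra.
    apply: le_trans (normc_geometric_le _ a0 a1) _.
    rewrite aE ler_pdivrMr //; last by rewrite -aE.
    have -> : (L i)%:R = 16 * i.+1%:R * ((q i.+1)%:R / (q i)%:R) :> R.
      rewrite /L !natrM; congr (_ * _).
      by rewrite -[in RHS](divnK (q_dvd i)) natrM mulfK // pnatr_eq0 -lt0n.
    have q0' : 0 < (q i)%:R :> R by rewrite ltr0n.
    rewrite [leRHS](_ : _ = 2 * pi * (16 * `|xi|) / (q i)%:R); last first.
      by field; rewrite ?gt_eqF // pnatr_eq0.
    by rewrite ler_pdivlMr //; nra.
  have jk : (j < k.+1)%N by [].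
  apply: (le_lt_trans (@masked_expi_le R (Lb k) k.+1 j
    (fun i => s * (q (start k + i).+1)%:R^-1) i.+1%:R^-1 jk h)).
  rewrite ltr_pM2r ?ltr0n ?(T_gt0 k) //.
  have k0 : 0 < k.+1%:R :> R by [].
  (* Both losses are at most [1 / k.+1], because [i >= start k >= k]. *)
  apply: (@le_lt_trans _ _ (2 / k.+1%:R)).
    rewrite -[2]/(1 + 1) mulrDl !mul1r lerD2l lef_pV2 ?posrE ?ltr0n // ler_nat.
    by rewrite ltnS iE (leq_trans (start_ge k)) // leq_addr.
  rewrite ltr_pdivrMr // -ltr_pdivrMl // mulrC (lt_le_trans hN) //.
  by rewrite ler_nat.
- exact: compact_gap_set.
- exact/gap_set_well_approximable/q_ge.
- apply: muK => [|t x].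
    by apply: closed_measurable; apply: compact_closed (@compact_gap_set R psi q).
  under eq_fun do rewrite vS.
  move=> Sx.
  (* Two-sided bounds holding for all large partial sums pass to the limit [x]. *)
  have in_lim (a b : R) N : (forall n, (N <= n)%N -> a <= S t (start n) <= b) ->
      a <= x <= b.
    move=> h; suff : `[a, b]%classic x by rewrite /= in_itv.
    apply: (closed_cvg _ (@interval_closed _ _ _ _ _) _ _ Sx) => //.
    by exists N => // n /= Nn; rewrite in_itv; exact: h.
  split; first by rewrite /= in_itv; apply: (in_lim _ _ 0%N) => n _; rewrite S_ge0 S_le.
  move=> k _; have [i ik di] : exists2 i : nat, (i < k.+1)%N & mdigit (t k) i = 0%N.
    (* The erased index of block [k] is the witness, whatever the realization. *)
    by exists (t k).1 => //; rewrite /mdigit eqxx.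
  exists i => //; set l := (start k + i)%N.
  have dl : d t l = 0%N by rewrite /d blockE.
  have [p p_le pE] := partial_sum_rat q0 q_lt q_dvd q_fast (d_lt t) l.
  exists p => //=; rewrite in_itv /= -pE.
  apply: (in_lim _ _ k.+1) => n kn.
  apply: (partial_sum_gap psi_gt0 psi_decr q0 q_lt q_dvd q_fast (d_lt t) dl).
  rewrite (leq_trans _ (leq_start kn)) // startS /l ltn_add2l //.
Qed.
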